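(* Let $\mathbb{K}$ be an arbitrary field, let $n \geq 3$ be an integer, and let $\mathbb{K}^{n,n}$ denote the algebra of $n \times n$ matrices with entries in $\mathbb{K}$. If $\mathcal{A}$ is a proper subalgebra of $\mathbb{K}^{n,n}$ (that is, $\mathcal{A} \neq \mathbb{K}^{n,n}$), then $\dim(\mathcal{A}) \leq n^2 - 2$, where $\dim(\mathcal{A})$ is the dimension of $\mathcal{A}$ as a vector space over $\mathbb{K}$.
   Context: A subalgebra of $\mathbb{K}^{n,n}$ is a $\mathbb{K}$-linear subspace closed under matrix multiplication; it is not assumed to contain the identity matrix. *)

(* Defs.v *)
From HB Require Import structures.
From mathcomp Require Import all_boot all_order all_algebra.

Set Implicit Arguments.
Unset Strict Implicit.
Unset Printing Implicit Defensive.

Import GRing.Theory.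
Local Open Scope ring_scope.

(* The library's {aspace _} is not used because its elements are required to
   contain a nonzero identity element. *)
Definition is_subalgebra (K : fieldType) (n : nat) (A : {vspace 'M[K]_n}) : Prop :=
  forall X Y : 'M[K]_n, X \in A -> Y \in A -> X *m Y \in A.

(* Main.v *)
Require Import Defs.
From mathcomp Require Import all_boot all_order all_algebra.

(** A proper subspace of dimension larger than [n ^ 2 - 2] is a hyperplane, so
    it is the kernel of a nonzero linear form [f] on the matrices.  If it is
    closed under multiplication, then the bilinear form [(X, Y) |-> f (X *m Y)]
    vanishes on pairs of elements of [ker f]; since [ker f] has codimension 1
    on each side, such a form has rank at most 2.  On the other hand its rank
    is at least [n]: if [f] does not vanish on the matrix unit [E_ij], then
    [f (E_ik *m E_lj) = (k == l) * f E_ij], so that row [i] and column [j] are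
    put in duality.  Hence [n <= 2].

    The rank argument is made explicit in [kernel_not_subalgebra]: with
    [f C = 1], a matrix [X] such that [f X = f (X *m C) = 0] satisfies
    [f (X *m Y) = 0] for all [Y].  These are only two linear conditions on [X],
    so for [n >= 3] they have a nonzero solution supported on row [i]
    ([common_zero_of_two_forms]), which contradicts the duality. *)

Section Subalgebras.

Import GRing.Theory.
Local Open Scope ring_scope.

Variable K : fieldType.

(** The form is the coordinate along a vector [c] outside [U], with respect to
    the decomposition of the space as [<[c]> + U]; hence it takes the value 1. *)
Lemma hyperplane_eq_kernel (vT : vectType K) (U : {vspace vT}) :
    \dim {:vT} = (\dim U).+1 ->
  exists f : 'Hom(vT, K^o),
    (exists v, f v = 1) /\ forall v, (v \in U) = (f v == 0).
Proof.
move=> dimU.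
have /subvPn[c _ cU] : ~~ (fullv <= U)%VS.
  by apply/negP=> /dimvS; rewrite dimU ltnn.
have c0 : c != 0 by apply: contraNneq cU => ->; apply: mem0v.
have capcU : (<[c]> :&: U = 0)%VS.
  apply/eqP; rewrite -subv0; apply/subvP => v.
  rewrite memv_cap => /andP[/vlineP[a ->]]; rewrite memv0.
  have [->|a0 acU] := eqVneq a 0; first by rewrite scale0r.
  by case/negP: cU; rewrite -[c](scalerK a0) memvZ.
have addcU : (<[c]> + U = fullv)%VS.
  apply/eqP; rewrite eqEdim subvf dimU dimv_disjoint_sum //.
  by rewrite dim_vline c0 add1n leqnn.
have pi_c v : daddv_pi <[c]> U v \in <[c]>%VS by apply: memv_pi.
pose g : {linear vT -> K^o} := coord [tuple c] 0 \o daddv_pi <[c]> U.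
have gK v : g v *: c = daddv_pi <[c]> U v.
  apply/esym; rewrite {1}(@coord_span _ _ _ [tuple c] (daddv_pi <[c]> U v)).
    by rewrite big_ord1.
  by rewrite span_seq1.
exists (linfun g); split=> [|v].
  exists c; rewrite lfunE; apply/eqP; rewrite -subr_eq0; apply/eqP.
  have /eqP : (g c - 1) *: c = 0.
    by rewrite scalerBl gK scale1r daddv_pi_id ?memv_line ?subrr.
  by rewrite scaler_eq0 (negPf c0) orbF => /eqP.
have decv := daddv_pi_add capcU (w := v).
rewrite lfunE; apply/idP/eqP => [vU | gv0].
  have : daddv_pi <[c]> U v \in (<[c]> :&: U)%VS.
    rewrite memv_cap pi_c.
    have -> : daddv_pi <[c]> U v = v - daddv_pi U <[c]> v.
      by rewrite -{2}decv ?addcU ?memvf // addrK.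
    by rewrite memvB ?memv_pi.
  by rewrite capcU memv0 -gK scaler_eq0 (negPf c0) orbF => /eqP.
by rewrite -decv ?addcU ?memvf // -gK gv0 scale0r add0r memv_pi.
Qed.

(** Intersecting with the kernel of a form lowers the dimension of a subspace by
    at most 1. *)
Lemma common_zero_of_two_forms (vT : vectType K) (f g : 'Hom(vT, K^o)) :
  (2 < \dim {:vT})%N -> exists2 v, v != 0 & f v = 0 /\ g v = 0.
Proof.
have dim_form (U : {vspace vT}) (h : 'Hom(vT, K^o)) :
    (\dim U <= (\dim (U :&: lker h)).+1)%N.
  rewrite -(limg_ker_dim h U) -addn1 leq_add2l.
  by apply: leq_trans (dimvS (subvf _)) _; rewrite dimvf.
move=> dim_gt2; set U := (fullv :&: lker f :&: lker g)%VS.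
have U0 : U != 0%VS.
  rewrite -dimv_eq0 -lt0n -ltnS -ltnS; apply: leq_trans dim_gt2 _.
  by apply: leq_trans (dim_form _ f) _; rewrite ltnS dim_form.
exists (vpick U); first by rewrite vpick0.
have := memv_pick U; rewrite !memv_cap !memv_ker => /andP[/andP[_ /eqP->]].
by move/eqP.
Qed.

(** If [f X = f (X *m C) = 0], then [f (X *m Y) = 0] for every [Y]: [Y] is the
    sum of [Y - f Y *: C], which is in [A] like [X], and of a multiple of [C].
    Choosing [X] nonzero on a row [i] that [f] sees makes this absurd. *)
Lemma kernel_not_subalgebra (n : nat) (A : {vspace 'M[K]_n})
    (f : 'Hom('M[K]_n, K^o)) (C : 'M[K]_n) :
    (2 < n)%N -> f C = 1 -> (forall X, (X \in A) = (f X == 0)) ->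
  ~ is_subalgebra A.
Proof.
move=> n_gt2 fC1 kerf mulA.
have [i [j fij]] : exists i j, f (delta_mx i j) != 0.
  have [/existsP[i /existsP[j ?]] | f0] :=
    boolP [exists i, exists j, f (delta_mx i j) != 0]; first by exists i, j.
  case/eqP: (oner_neq0 K); rewrite -fC1 [C]matrix_sum_delta linear_sum big1 //.
  move=> i _; rewrite linear_sum big1 // => j _; rewrite linearZ /=.
  move: f0; rewrite negb_exists => /forallP/(_ i).
  rewrite negb_exists => /forallP/(_ j); rewrite negbK => /eqP->.
  by rewrite scaler0.
pose rowi (x : 'rV[K]_n) : 'M[K]_n := delta_mx i ord0 *m x.
pose form D : {linear 'rV[K]_n -> K^o} :=
  f \o mulmxr D \o mulmx (delta_mx i (ord0 : 'I_1)).
have formE D x : linfun (form D) x = f (rowi x *m D) by rewrite lfunE.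
have [|x x0 []] :=
  common_zero_of_two_forms _ (linfun (form 1%:M)) (linfun (form C)).
  by rewrite dimvf /dim /= mul1n.
rewrite !formE mulmx1 => fx0 fxC0.
have fxY Y : f (rowi x *m Y) = 0.
  have fXC : f (rowi x *m (f Y *: C)) = 0.
    by rewrite -scalemxAr linearZ /= fxC0 scaler0.
  rewrite -[Y](subrK (f Y *: C)) mulmxDr linearD /= fXC addr0.
  apply/eqP; rewrite -kerf mulA ?kerf ?fx0 //.
  by rewrite linearB linearZ /= fC1 [_ *: _]mulr1 subrr.
(* Testing against [E_kj] recovers the [k]-th entry of [x], up to [f E_ij]. *)
case/eqP: x0; apply/rowP => k; rewrite mxE.
have := fxY (delta_mx k j).
have -> : rowi x *m delta_mx k j = x 0 k *: delta_mx i j.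
  rewrite -(mul_delta_mx (0 : 'I_1) k j) /rowi -mulmxA (mulmxA x) -colE.
  have -> : col k x = (x 0 k)%:M by apply/matrixP=> a b; rewrite !ord1 !mxE.
  by rewrite mul_scalar_mx -scalemxAr mul_delta_mx.
rewrite linearZ /= => /eqP; rewrite scaler_eq0 (negPf fij) orbF.
by move/eqP.
Qed.

End Subalgebras.

Theorem theorem1 (K : fieldType) (n : nat) (hn : (3 <= n)%N)
    (A : {vspace 'M[K]_n}) (hA : is_subalgebra A)
    (hproper : A <> fullv) :
  (\dim A <= n ^ 2 - 2)%N.
Proof.
rewrite leqNgt; apply/negP => dimA_gt.
have dim_full : \dim (fullv : {vspace 'M[K]_n}) = n ^ 2.
  by rewrite dimvf /dim /= mulnn.
have dimA_lt : \dim A < n ^ 2.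
  rewrite -dim_full ltnNge; apply/negP => dimA_ge.
  by apply: hproper; apply/eqP; rewrite eqEdim subvf dimA_ge.
have codim1 : \dim (fullv : {vspace 'M[K]_n}) = (\dim A).+1.
  apply/eqP; rewrite dim_full eqn_leq dimA_lt andbT.
  by case: (\dim A) dimA_gt => // d; rewrite ltnS leq_subLR.
have [f [[C fC1] kerf]] := hyperplane_eq_kernel _ _ _ codim1.
exact: kernel_not_subalgebra _ _ _ _ hn fC1 kerf hA.
Qed.
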